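(* Let $U\subseteq R^m(-\mathbf d)$ be a quasi-stable module. The functor $\underline{\mathbf{Mf}}^{\mathrm{syz}}_U$ is represented by the scheme $\mathbf{Mf}^{\mathrm{syz}}_U:=\mathrm{Spec}(\mathbb K[B,C]/\mathscr S)$.
   Context: $\mathbb K$ is a field, $R=\mathbb K[x_0,\dots,x_n]$ with the standard grading and $x_0<\dots<x_n$; for a $\mathbb K$-algebra $A$, $R_A=R\otimes_{\mathbb K}A$. A term of $R$ is a monomial $x^\alpha$; for $x^\alpha\neq1$, $\min(x^\alpha)$, $\max(x^\alpha)$ are the smallest and largest variable dividing it. Variables $x_i>\min(x^\alpha)$ are non-multiplicative for $x^\alpha$ (the term $1$ has none). $R_A^m(-\mathbf d)=\bigoplus_k R_A(-d_k)\mathbf e_k$, with terms $x^\alpha\mathbf e_k$ of degree $|\alpha|+d_k$. All submodules are graded. For a monomial submodule $U$ (generated by terms), $\mathcal N(U)$ is the set of terms not in $U$. Pommaret cone: $\mathcal C(x^\alpha)=\{x^\delta x^\alpha\mid\delta_i=0\ \forall x_i>\min(x^\alpha)\}$ for $x^\alpha\neq 1$, $\mathcal C(1)=$ all terms, $\mathcal C(x^\alpha\mathbf e_k)=\mathcal C(x^\alpha)\mathbf e_k$. A Pommaret basis of $U$ is a set of terms generating $U$ whose cones partition the set of terms of $U$; it is unique if it exists, denoted $\mathcal P_U$. $U$ is quasi-stable if it has a finite Pommaret basis, stable if moreover $\mathcal P_U$ is its minimal monomial generating set. A $U$-marked set is a finite set $F=\{f_{\alpha,k}\}_{x^\alpha\mathbf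 e_k\in\mathcal P_U}\subset R_A^m(-\mathbf d)$ of homogeneous elements such that $x^\alpha\mathbf e_k$ has coefficient $1$ in $f_{\alpha,k}$ and the support of $f_{\alpha,k}-x^\alpha\mathbf e_k$ is in $\mathcal N(U)$; it is a $U$-marked basis of $(F)$ if $R_A^m(-\mathbf d)=(F)\oplus\langle\mathcal N(U)\rangle_A$. A graded submodule $M$ satisfies $M\oplus\langle\mathcal N(U)\rangle=R_A^m(-\mathbf d)$ iff it is generated by a (necessarily unique) $U$-marked basis. Functor (Noetherian $\mathbb K$-algebras to sets): $\underline{\mathbf{Mf}}^{\mathrm{syz}}_U(A)$ is the set of pairs $(M,S_1)$ with $M\subset R_A^m(-\mathbf d)$, $M\oplus\langle\mathcal N(U)\rangle=R_A^m(-\mathbf d)$, and $S_1$ the module of first syzygies of the $U$-marked basis $F$ of $M$; on morphisms it acts by extension of scalars. Parameters. $C=\{C_{\alpha,k}^{\beta,\ell}\mid x^\alpha\mathbf e_k\in\mathcal P_U,\ x^\beta\mathbf e_\ell\in\mathcal N(U),\ \deg x^\beta\mathbf e_\ell=\deg x^\alpha\mathbf e_k\}$ are indeterminates, and $\mathcal F=\{F_{\alpha,k}\}$ with $F_{\alpha,k}=x^\alpha\mathbf e_k-\sum C_{\alpha,k}^{\beta,\ell}x^\beta\mathbf e_\ell\in R^m_{\mathbb K[C]}(-\mathbf d)$ is the generic $U$-marked set. Let $\mathbf f_{\alpha,k}$ be free basis elements of degree $\deg x^\alpha\mathbf e_k$ indexed by $\mathcal P_U$, and let $U^{(1)}$ be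 the stable submodule of $\bigoplus R\,\mathbf f_{\alpha,k}$ with Pommaret basis $\{x_i\mathbf f_{\alpha,k}\mid x_i>\min(x^\alpha)\}$. For $x_i>\min(x^\alpha)$ let $\mathsf s_{i,\alpha,k}$ be the set of terms $x^\eta\mathbf f_{\gamma,\ell}\in\mathcal N(U^{(1)})$ with $x^\gamma\mathbf e_\ell\in\mathcal P_U$, $\max(x^\eta)\le\min\{x_{i-1},\min(x^\gamma)\}$ ($x^\eta=1$ allowed; if $x^\gamma=1$ only $\max(x^\eta)\le x_{i-1}$ is required) and $\deg x^\eta\mathbf f_{\gamma,\ell}=\deg x^\alpha\mathbf e_k+1$. $B$ is the set of indeterminates $B_{i,\alpha,k}^{\eta,\gamma,\ell}$, one for each $(i,\alpha,k)$ and each $x^\eta\mathbf f_{\gamma,\ell}\in\mathsf s_{i,\alpha,k}$. $\mathscr S\subseteq\mathbb K[B,C]$ is the ideal generated by the coefficients (with respect to the terms $x^\epsilon\mathbf e_h$) of all elements $x_iF_{\alpha,k}-\sum_{x^\eta\mathbf f_{\gamma,\ell}\in\mathsf s_{i,\alpha,k}}B_{i,\alpha,k}^{\eta,\gamma,\ell}\,x^\eta F_{\gamma,\ell}$, for $x^\alpha\mathbf e_k\in\mathcal P_U$ and $x_i>\min(x^\alpha)$. *)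

(* Defs.v *)
From HB Require Import structures.
From mathcomp Require Import all_boot all_order all_algebra.
From mathcomp Require Import finmap.
From mathcomp Require Import boolp classical_sets.
From mathcomp Require Import mpoly.
From mathcomp Require Import ring_quotient.
From mathcomp Require Import zify.

Set Implicit Arguments.
Unset Strict Implicit.
Unset Printing Implicit Defensive.

Import GRing.Theory.
Local Open Scope ring_scope.
Local Open Scope classical_set_scope.

Section Submodules.
Variables (R : nzRingType) (V : lmodType R).

Definition submodule (M : set V) : Prop :=
  M 0 /\ forall a u v, M u -> M v -> M (a *: u + v).

Definition span (X : set V) : set V :=
  [set v | exists s : seq (R * V),
     (forall q, q \in s -> X q.2) /\ v = \sum_(q <- s) q.1 *: q.2].

Definition direct_sum (M N : set V) : Prop :=
  (forall v, exists u w, [/\ M u, N w & v = u + w])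
  /\ (forall v, M v -> N v -> v = 0).

End Submodules.

(* The ring is given explicitly: for an algebra over K, linear combinations
   must not be inferred to be K-linear. *)
Definition ideal (A : comNzRingType) (J : set A) : Prop := @submodule A A^o J.
Definition ideal_span (A : comNzRingType) (X : set A) : set A := @span A A^o X.

Definition noetherian (A : comNzRingType) : Prop :=
  forall J : set A, ideal J -> exists s : seq A, J = ideal_span [set` s].

(* terms x^a e_k of a free module whose basis (e_k) is indexed by I *)
Notation mterm n I := ('X_{1..n.+1} * I)%type.

Section Terms.
Variable n : nat.
Implicit Types a : 'X_{1..n.+1}.

(* None exactly when the term is 1 *)
Definition minvar a : option 'I_n.+1 :=
  [pick i : 'I_n.+1 | (0 < a i)%N && [forall j : 'I_n.+1, (0 < a j)%N ==> (i <= j)%N]].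

Definition maxvar a : option 'I_n.+1 :=
  [pick i : 'I_n.+1 | (0 < a i)%N && [forall j : 'I_n.+1, (0 < a j)%N ==> (j <= i)%N]].

Definition nonmult a (i : 'I_n.+1) : bool :=
  if minvar a is Some j then (j < i)%N else false.

(* max(x^e) <= min {x_{i-1}, min(x^a)}; only used for nonmultiplicative x_i,
   for which i > 0 *)
Definition max_le (e a : 'X_{1..n.+1}) (i : 'I_n.+1) : bool :=
  if maxvar e is Some j then
    (j <= i.-1)%N && (if minvar a is Some l then (j <= l)%N else true)
  else true.

Variable I : finType.
Implicit Types t u : mterm n I.

(* degree, when e_k has degree d k *)
Definition tdeg (d : I -> int) t : int := (mdeg t.1)%:Z + d t.2.

Definition cone t : set (mterm n I) :=
  [set u | exists2 a : 'X_{1..n.+1}, (forall i, nonmult t.1 i -> a i = 0%N) &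
           u = ((a + t.1)%MM, t.2)].

Definition terms_of_degree (d : I -> int) (e : int) : {fset mterm n I} :=
  [fset t in [seq (val b, k)
              | k <- enum I, b <- enum {: 'X_{1..n.+1 < `|e - d k|.+1}}]
        | tdeg d t == e]%fset.

Lemma in_terms_of_degree d e t : (t \in terms_of_degree d e) = (tdeg d t == e).
Proof.
rewrite !inE /=; case: eqP; rewrite ?andbF ?andbT // => dt.
apply/allpairsPdep; exists t.2.
have lt : (mdeg t.1 < `|e - d t.2|.+1)%N by rewrite -dt /tdeg addrK.
exists (BMultinom lt); split; rewrite ?mem_enum //=.
by case: (t).
Qed.

End Terms.

Notation fmod A n I := {ffun I -> {mpoly A[n.+1]}^o}.

Section FreeModule.
Variables (A : comNzRingType) (n : nat) (I : finType).
Implicit Types (t : mterm n I) (v : fmod A n I).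

Definition tm t : fmod A n I := [ffun k => if k == t.2 then 'X_[t.1] else 0].

Definition tcoef t v : A := (v t.2 : {mpoly A[n.+1]})@_t.1.

(* the A-linear span of a set of terms *)
Definition tspan (N : set (mterm n I)) : set (fmod A n I) :=
  [set v | exists s : seq (A * mterm n I),
     (forall q, q \in s -> N q.2) /\
     v = \sum_(q <- s) (q.1%:MP : {mpoly A[n.+1]}) *: tm q.2].

Definition homogeneous (d : I -> int) (e : int) v : Prop :=
  forall t, tcoef t v != 0 -> tdeg d t = e.

Definition graded (d : I -> int) (M : set (fmod A n I)) : Prop :=
  forall v, M v -> exists s : seq (fmod A n I),
    (forall w, w \in s -> M w /\ exists e, homogeneous d e w)
    /\ v = \sum_(w <- s) w.

End FreeModule.

Section ScalarExtension.
Variables (A A' : comNzRingType) (phi : {rmorphism A -> A'}) (n : nat) (I : finType).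

Definition map_fmod (v : fmod A n I) : fmod A' n I :=
  [ffun k => map_mpoly phi (v k : {mpoly A[n.+1]})].

(* the image of M (x)_A A' in the free module over A' *)
Definition extend (M : set (fmod A n I)) : set (fmod A' n I) :=
  span (R := {mpoly A'[n.+1]}) (map_fmod @` M).

End ScalarExtension.

Section Monomial.
Variables (K : fieldType) (n : nat) (I : finType).
Implicit Types (U : set (fmod K n I)) (P : {fset mterm n I}).

Definition monomial U : Prop :=
  exists T : set (mterm n I), U = span (R := {mpoly K[n.+1]}) (@tm K n I @` T).

Definition terms_in U : set (mterm n I) := [set t | U (tm K t)].

Definition Nterms U : set (mterm n I) := ~` terms_in U.

Definition pommaret_basis U P : Prop :=
  U = span (R := {mpoly K[n.+1]}) (@tm K n I @` [set` P]) /\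
  partition [set` P] (@cone n I) (terms_in U).

Definition quasi_stable U : Prop :=
  monomial U /\ exists P : {fset mterm n I}, pommaret_basis U P.

End Monomial.

Section Marked.
Variables (K : fieldType) (n : nat) (I : finType) (d : I -> int).
Variables (U : set (fmod K n I)) (P : {fset mterm n I}).
Variable A : comNzRingType.
Implicit Types F : P -> fmod A n I.

Definition marked_set F : Prop := forall t : P,
  [/\ exists e, homogeneous d e (F t),
      tcoef (val t) (F t) = 1 &
      forall u, tcoef u (F t - tm A (val t)) != 0 -> Nterms U u].

Definition marked_basis F : Prop :=
  marked_set F /\ direct_sum (span (R := {mpoly A[n.+1]}) (range F)) (@tspan A n I (Nterms U)).

Definition syzygies F : set (fmod A n P) :=
  [set s : fmod A n P | \sum_(t : P) (s t : {mpoly A[n.+1]}) *: F t = 0].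

Definition Mf_syz : set (set (fmod A n I) * set (fmod A n P)) :=
  [set p | [/\ submodule (R := {mpoly A[n.+1]}) p.1, graded d p.1,
               direct_sum p.1 (@tspan A n I (Nterms U)) &
               exists F, [/\ marked_basis F, p.1 = span (R := {mpoly A[n.+1]}) (range F) &
                             p.2 = syzygies F]]].

End Marked.

Definition extend_pair (A A' : comNzRingType) (phi : {rmorphism A -> A'}) (n : nat)
    (I J : finType) (p : set (fmod A n I) * set (fmod A n J)) :
    set (fmod A' n I) * set (fmod A' n J) :=
  (extend phi p.1, extend phi p.2).

(* Spec Q represents the functor A |-> X A on Noetherian K-algebras: morphisms
   Spec A -> Spec Q are the homomorphisms of K-algebras Q -> A, and Phi is the
   natural bijection. X A is a subset of E A, on which morphisms act by emap;
   naturality and surjectivity of Phi entail that emap sends X A into X A'. *)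
Definition represents (K : fieldType) (Q : comAlgType K)
    (E : comAlgType K -> Type)
    (emap : forall A A' : comAlgType K, {lrmorphism A -> A'} -> E A -> E A')
    (X : forall A : comAlgType K, set (E A)) : Prop :=
  exists Phi : forall A : comAlgType K, {lrmorphism Q -> A} -> E A,
    (forall A : comAlgType K, noetherian A ->
       [/\ forall h, X A (Phi A h),
           forall g h, Phi A g = Phi A h -> g =1 h &
           forall p, X A p -> exists h, Phi A h = p]) /\
    (forall (A A' : comAlgType K), noetherian A -> noetherian A' ->
       forall (phi : {lrmorphism A -> A'}) (h : {lrmorphism Q -> A}),
         Phi A' (phi \o h) = emap A A' phi (Phi A h)).

Section Coefficients.
Variables (K : fieldType) (n : nat) (I : finType) (d : I -> int).
Variables (U : set (fmod K n I)) (P : {fset mterm n I}).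

(* U^(1), inside the free module with basis f_t for t in P, given by the
   generators that form its Pommaret basis *)
Definition U1 : set (fmod K n P) :=
  span (R := {mpoly K[n.+1]}) [set v | exists (t : P) (i : 'I_n.+1),
          nonmult (val t).1 i /\ v = tm K ((U_(i))%MM, t)].

Definition tail_terms (t : P) : {fset mterm n I} :=
  [fset u in terms_of_degree n d (tdeg d (val t)) | `[< Nterms U u >]]%fset.

Lemma in_tail_terms t u : (u \in tail_terms t) =
  (tdeg d u == tdeg d (val t)) && `[< Nterms U u >].
Proof. by rewrite in_fset [LHS]inE /= in_terms_of_degree. Qed.

Definition Cvar : finType := {t : P & tail_terms t}.

Definition nm_pair : finType := {q : 'I_n.+1 * P | nonmult (val q.2).1 q.1}.

Definition s_terms (q : nm_pair) : {fset mterm n P} :=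
  [fset w in terms_of_degree n (fun t : P => tdeg d (val t))
               (tdeg d (val (val q).2) + 1)
     | `[< Nterms U1 w >] && max_le w.1 (val w.2).1 (val q).1]%fset.

Lemma in_s_terms q w : (w \in s_terms q) =
  [&& tdeg (fun t : P => tdeg d (val t)) w == tdeg d (val (val q).2) + 1,
      `[< Nterms U1 w >] & max_le w.1 (val w.2).1 (val q).1].
Proof. by rewrite in_fset [LHS]inE /= in_terms_of_degree. Qed.

Definition Bvar : finType := {q : nm_pair & s_terms q}.

Definition KBC : comAlgType K := {mpoly K[#|{: Bvar + Cvar}|]}.

Definition Bind (b : Bvar) : KBC := 'X_(enum_rank (inl b : Bvar + Cvar)%type).
Definition Cind (c : Cvar) : KBC := 'X_(enum_rank (inr c : Bvar + Cvar)%type).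

(* the generic marked set, over K[C] regarded inside K[B, C] *)
Definition generic_marked (t : P) : fmod KBC n I :=
  tm KBC (val t) -
  \sum_(u : tail_terms t)
    ((Cind (Tagged _ u))%:MP : {mpoly KBC[n.+1]}) *: tm KBC (val u).

Definition generic_syz (q : nm_pair) : fmod KBC n I :=
  ('X_(val q).1 : {mpoly KBC[n.+1]}) *: generic_marked (val q).2 -
  \sum_(w : s_terms q)
    ((Bind (Tagged _ w))%:MP * 'X_[(val w).1] : {mpoly KBC[n.+1]})
      *: generic_marked (val w).2.

Definition Sideal : set KBC :=
  ideal_span [set a | exists q e, a = tcoef e (generic_syz q)].

End Coefficients.

Arguments U1 K {n I} P.
Arguments s_terms K {n I} d {P} q.
Arguments Bvar K {n I} d P.
Arguments Sideal {K n I} d U P.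
Arguments Cvar {K n I} d U P.
Arguments KBC {K n I} d U P.

Section QuotientAlgebra.
Variables (K : fieldType) (R : comAlgType K) (J : idealr R).

Definition quotalg : Type := {ideal_quot J}.
HB.instance Definition _ := GRing.ComNzRing.on quotalg.

Definition quot_pi (p : R) : quotalg := (\pi_({ideal_quot J}) p)%qT.

Lemma quot_pi_zmod : zmod_morphism quot_pi.
Proof. exact: (raddfB (\pi_({ideal_quot J}))%qT). Qed.

Lemma quot_pi_monoid : monoid_morphism quot_pi.
Proof.
split; first exact: (rmorph1 (\pi_({ideal_quot J}))%qT).
exact: (rmorphM (\pi_({ideal_quot J}))%qT).
Qed.

HB.instance Definition _ := GRing.isZmodMorphism.Build R quotalg quot_pi quot_pi_zmod.
HB.instance Definition _ := GRing.isMonoidMorphism.Build R quotalg quot_pi quot_pi_monoid.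

Definition quot_scale (a : K) (x : quotalg) : quotalg := quot_pi a%:A * x.

Lemma quot_scaleA a b x : quot_scale a (quot_scale b x) = quot_scale (a * b) x.
Proof. by rewrite /quot_scale mulrA -rmorphM /= -scalerAl mul1r scalerA. Qed.

Lemma quot_scale1 : left_id 1 quot_scale.
Proof. by move=> x; rewrite /quot_scale scale1r rmorph1 mul1r. Qed.

Lemma quot_scaleDr : right_distributive quot_scale +%R.
Proof. by move=> a x y; rewrite /quot_scale mulrDr. Qed.

Lemma quot_scaleDl x : {morph quot_scale^~ x : a b / a + b}.
Proof. by move=> a b; rewrite /quot_scale scalerDl rmorphD mulrDl. Qed.

HB.instance Definition _ := GRing.Zmodule_isLmodule.Build K quotalg
  quot_scaleA quot_scale1 quot_scaleDr quot_scaleDl.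

Lemma quot_scaleAl (a : K) (x y : quotalg) : a *: (x * y) = (a *: x) * y.
Proof. exact: mulrA. Qed.

HB.instance Definition _ := GRing.Lmodule_isLalgebra.Build K quotalg quot_scaleAl.
HB.instance Definition _ := GRing.Lalgebra_isComAlgebra.Build K quotalg.

Lemma quot_pi_scalable : scalable quot_pi.
Proof.
move=> a p; rewrite -[a *: quot_pi p]/(quot_pi a%:A * quot_pi p).
by rewrite -rmorphM -scalerAl mul1r.
Qed.

HB.instance Definition _ := GRing.isScalable.Build K R quotalg *:%R quot_pi
  quot_pi_scalable.

Lemma quot_pi_eq0 (p : R) : (quot_pi p == 0) = (p \in (J : pred R)).
Proof.
rewrite -[p in RHS]subr0 Quotient.idealrBE.
by rewrite -[(\pi_(_) 0)%qT]/(quot_pi 0) rmorph0.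
Qed.

End QuotientAlgebra.

Section Span.
Variables (R : nzRingType) (V : lmodType R) (X : set V).

Lemma span_sub v : X v -> span X v.
Proof.
move=> Xv; exists [:: (1, v)]; split; last by rewrite big_seq1 scale1r.
by move=> q; rewrite inE => /eqP ->.
Qed.

Lemma span_submodule : submodule (span X).
Proof.
split; first by exists [::]; split => //; rewrite big_nil.
move=> a u v [s [sX ->]] [r [rX ->]].
exists ([seq (a * q.1, q.2) | q <- s] ++ r); split.
  move=> q; rewrite mem_cat => /orP[/mapP[p ps ->]|]; first exact: (sX _ ps).
  exact: rX.
rewrite big_cat big_map scaler_sumr /=; congr (_ + _).
by apply: eq_bigr => q _; rewrite scalerA.
Qed.

End Span.

Section Proper.
Variables (K : fieldType) (n : nat) (I : finType) (d : I -> int).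
Variables (U : set (fmod K n I)) (P : {fset mterm n I}).
Hypothesis hP : pommaret_basis U P.

Local Notation KBC := (KBC d U P).

Lemma minvarP (a : 'X_{1..n.+1}) i : minvar a = Some i ->
  (0 < a i)%N /\ forall j, (0 < a j)%N -> (i <= j)%N.
Proof.
rewrite /minvar; case: pickP => // k /andP[ak /forallP h] [<-].
by split=> // j; apply/implyP/h.
Qed.

Lemma minvarN (a : 'X_{1..n.+1}) : minvar a = None -> a = 0%MM.
Proof.
rewrite /minvar; case: pickP => // h _; apply/mnmP => i; rewrite mnm0E.
apply/eqP/negPn; rewrite -lt0n; apply/negP => ai.
case: (@arg_minnP _ i (fun j : 'I_n.+1 => 0 < a j)%N (fun j : 'I_n.+1 => nat_of_ord j) ai) => j aj hj.
by have /negP[] := h j; rewrite aj; apply/forallP => k; apply/implyP/hj.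
Qed.

Lemma maxvarP (a : 'X_{1..n.+1}) i : maxvar a = Some i ->
  (0 < a i)%N /\ forall j, (0 < a j)%N -> (j <= i)%N.
Proof.
rewrite /maxvar; case: pickP => // k /andP[ak /forallP h] [<-].
by split=> // j; apply/implyP/h.
Qed.

Lemma tcoef_tm (A : comNzRingType) (J : finType) (t u : mterm n J) :
  tcoef u (tm A t) = (t == u)%:R.
Proof.
rewrite /tcoef ffunE -pair_eqE /pair_eq eq_sym andbC.
by rewrite [t.2 == _]eq_sym; case: eqP; rewrite ?mcoeffX ?mcoeff0 // eq_sym.
Qed.

Lemma tcoef_map (A A' : comNzRingType) (f : {rmorphism A -> A'})
  (t : mterm n I) v : tcoef t (map_fmod f v) = f (tcoef t v).
Proof. by rewrite /tcoef ffunE mcoeff_map_mpoly. Qed.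

Lemma tmZ (A : comNzRingType) (J : finType) (a : 'X_{1..n.+1}) (t : mterm n J) :
  ('X_[a] : {mpoly A[n.+1]}) *: tm A t = tm A ((a + t.1)%MM, t.2).
Proof.
apply/ffunP => k; rewrite !ffunE /=; case: eqP => _; last exact: mulr0.
by rewrite -['X_[a] *: _]/('X_[a] * 'X_[t.1]) mpolyXD.
Qed.

Lemma mcoeffMX0 (A : comNzRingType) (p : {mpoly A[n.+1]}) (i : 'I_n.+1)
  (a : 'X_{1..n.+1}) : a i = 0%N -> (p * 'X_i)@_a = 0.
Proof.
move=> ai; rewrite [p]mpolyE mulr_suml raddf_sum /= big1 // => b _.
rewrite -scalerAl -mpolyXD mcoeffZ mcoeffX; case: eqP => [ba|]; last by rewrite mulr0.
by move: ai; rewrite -ba mnmDE mnm1E eqxx addn1.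
Qed.

Lemma Nterms_U1 (w : mterm n P) :
  Nterms (U1 K P) w <-> forall i, nonmult (val w.2).1 i -> w.1 i = 0%N.
Proof.
split=> [Nw i wi|hw [s [sX]]].
  apply/eqP/negPn; rewrite -lt0n; apply/negP => wi0; apply: Nw.
  exists [:: ('X_[(w.1 - U_(i))%MM], tm K ((U_(i))%MM, w.2))]; split.
    by move=> q; rewrite inE => /eqP ->; exists w.2, i.
  rewrite big_seq1 /= tmZ /= submK -?surjective_pairing //.
  by apply/mnm_lepP => j; rewrite mnm1E; case: eqP => // <-.
move/(congr1 (tcoef w)); rewrite tcoef_tm eqxx => /eqP.
rewrite /tcoef sum_ffunE raddf_sum big_seq big1 ?oner_eq0 // => q /sX [t [i [ti ->]]].
rewrite !ffunE /=; case: eqP => [wt|_]; last by rewrite [_ *: _]mulr0 mcoeff0.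
by rewrite [_ *: _]/(_ * _) mcoeffMX0 // hw // wt.
Qed.

Lemma terms_in_P (t : P) : terms_in U (val t).
Proof.
rewrite /terms_in /= hP.1; apply: span_sub; exists (val t) => //.
exact: valP t.
Qed.

Lemma pommaret_nonmult (q : nm_pair P) : exists w : s_terms K d q,
  ((U_((val q).1) + (val (val q).2).1)%MM, (val (val q).2).2)
   == (((val w).1 + (val (val w).2).1)%MM, (val (val w).2).2).
Proof.
case: hP => UP [cov triv _].
set i := (val q).1; set t := (val q).2.
have ti : nonmult (val t).1 i := valP q.
have Uit : terms_in U ((U_(i) + (val t).1)%MM, (val t).2).
  rewrite /terms_in /= -tmZ UP -[_ *: _]addr0.
  have [S0 S] := span_submodule (@tm K n I @` [set` P]).
  by apply: S => //; rewrite -UP; exact: terms_in_P.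
move: (Uit); rewrite -cov => -[t' t'P [a am e]].
pose t1 : P := [` t'P]%fset.
have ei j : ((U_(i) + (val t).1)%MM j = a j + t'.1 j)%N by have /= -> := congr1 fst e; rewrite mnmDE.
have e2 : (val t).2 = t'.2 := congr1 snd e.
have ai : a i = 0%N.
  apply/eqP/negPn; rewrite -lt0n; apply/negP => ai.
  have ctt : cone t' (val t).
    exists (a - U_(i))%MM.
      by move=> j /am aj; rewrite mnmBE aj.
    rewrite [LHS]surjective_pairing e2; congr pair; apply/mnmP => j.
    have := ei j; rewrite !(mnmDE, mnmBE, mnm1E).
    by case: eqP => [<-|_]; move: ai => /=; lia.
  have tt : cone (val t) (val t).
    by exists 0%MM => [j _|]; rewrite ?mnm0E // add0m -surjective_pairing.
  have E : t' = val t.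
    by apply: triv => //; [exact: valP t|exists (val t)].
  by move: (am i); rewrite E => /(_ ti) a0; rewrite a0 in ai.
have win : (a, t1) \in s_terms K d q.
  rewrite in_s_terms; apply/and3P; split.
  - rewrite /tdeg /= -e2 -/t.
    have := congr1 (fun u => mdeg u.1) e; rewrite /= !mdegD mdeg1 => em.
    by apply/eqP; lia.
  - by apply/asboolP/Nterms_U1.
  - rewrite /max_le; case ma : (maxvar a) => [j|//]; have [aj _] := maxvarP ma.
    have jm : is_true (if minvar t'.1 is Some l then (j <= l)%N else true).
      case E : (minvar t'.1) => [l|//]; rewrite leqNgt; apply/negP => lj.
      by move: aj; rewrite am // /nonmult E.
    apply/andP; split; last exact: jm.
    suff ji : (j < i)%N by rewrite -ltnS (ltn_predK ji).
    rewrite ltnNge; apply/negP => ij.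
    have {}ij : (i < j)%N.
      rewrite ltn_neqAle ij andbT; apply/eqP => /val_inj ijE.
      by move: aj; rewrite -ijE ai.
    have := ei i; rewrite ai mnmDE mnm1E eqxx add0n => t'i.
    move: jm; case E : (minvar t'.1) => [l|].
      by have [_ /(_ i)] := minvarP E; rewrite -t'i => /(_ isT); lia.
    by move: t'i; rewrite (minvarN E) mnm0E.
by exists [` win]%fset; apply/eqP.
Qed.

(* The K-point of K[B, C] corresponding to M = U is a zero of S, so that S is a
   proper ideal and the quotient is a (nonzero) K-algebra. *)
Definition pt (x : (Bvar K d P + Cvar d U P)%type) : K :=
  match x with
  | inl b => (projT2 b == xchoose (pommaret_nonmult (projT1 b)))%:R
  | inr _ => 0
  end.

Definition evpt : KBC -> K := meval (fun j => pt (enum_val j)).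
HB.instance Definition _ := GRing.RMorphism.on evpt.

Lemma map_fmodB (A A' : comNzRingType) (f : {rmorphism A -> A'}) (u v : fmod A n I) :
  map_fmod f (u - v) = map_fmod f u - map_fmod f v.
Proof. by apply/ffunP => k; rewrite !ffunE; exact: (rmorphB (map_mpoly f)). Qed.

Lemma map_fmodZ (A A' : comNzRingType) (f : {rmorphism A -> A'})
  (p : {mpoly A[n.+1]}) (v : fmod A n I) :
  map_fmod f (p *: v) = (map_mpoly f p : {mpoly A'[n.+1]}) *: map_fmod f v.
Proof. by apply/ffunP => k; rewrite !ffunE; exact: (rmorphM (map_mpoly f)). Qed.

Lemma map_fmod_sum (A A' : comNzRingType) (f : {rmorphism A -> A'})
  (J : finType) (v : J -> fmod A n I) :
  map_fmod f (\sum_j v j) = \sum_j map_fmod f (v j).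
Proof.
apply/ffunP => k; rewrite !(ffunE, sum_ffunE).
by rewrite (raddf_sum (map_mpoly f)); apply: eq_bigr => j _; rewrite ffunE.
Qed.

Lemma map_fmod_tm (A A' : comNzRingType) (f : {rmorphism A -> A'}) (t : mterm n I) :
  map_fmod f (tm A t) = tm A' t.
Proof.
by apply/ffunP => k; rewrite !ffunE; case: eqP; rewrite ?map_mpolyX ?raddf0.
Qed.

Lemma evpt_B b : evpt (Bind U b) = pt (inl b).
Proof. by rewrite /evpt mevalXU enum_rankK. Qed.

Lemma ev_marked t : map_fmod evpt (generic_marked d U t) = tm K (val t).
Proof.
rewrite map_fmodB map_fmod_tm map_fmod_sum big1 ?subr0 // => u _.
rewrite map_fmodZ map_mpolyC /Cind /= /evpt mevalXU enum_rankK /=.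
by rewrite mpolyC0 scale0r.
Qed.

Lemma ev_syz q : map_fmod evpt (generic_syz d U q) = 0.
Proof.
rewrite map_fmodB map_fmodZ ev_marked map_mpolyX tmZ map_fmod_sum.
set w0 := xchoose (pommaret_nonmult q).
rewrite (bigD1 w0) //= big1 ?addr0 => [|w ww0].
  rewrite map_fmodZ ev_marked rmorphM /= map_mpolyX map_mpolyC.
  rewrite [X in X%:MP]evpt_B /= eqxx mpolyC1 mul1r tmZ.
  by rewrite (eqP (xchooseP (pommaret_nonmult q))) subrr.
rewrite map_fmodZ ev_marked rmorphM /= map_mpolyC.
by rewrite [X in X%:MP]evpt_B /= (negPf ww0) mpolyC0 mul0r scale0r.
Qed.

Lemma Sideal_closed :
  idealr_closed (fun p : KBC => `[< Sideal d U P p >]).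
Proof.
have [S0 S] : ideal (Sideal d U P) by exact: span_submodule.
split; first (by rewrite unfold_in; exact/asboolP); last first.
  move=> a u v; rewrite !unfold_in => /asboolP hu /asboolP hv.
  by apply/asboolP; exact: S.
apply/negP; rewrite unfold_in => /asboolP [s [sX /(congr1 evpt)]].
rewrite rmorph1 rmorph_sum big_seq big1 => [/eqP|p /sX [q [e ->]]].
  by rewrite oner_eq0.
by rewrite rmorphM /= -tcoef_map ev_syz /tcoef ffunE mcoeff0 mulr0.
Qed.

Definition Sidealr : idealr KBC :=
  HB.pack (fun p : KBC => `[< Sideal d U P p >])
    (isIdealr.Build KBC _ Sideal_closed).

Definition KBC_mod_S : comAlgType K := quotalg Sidealr.

End Proper.

(* Main.v *)
Require Import Defs.
From HB Require Import structures.
From mathcomp Require Import all_boot all_order all_algebra.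
From mathcomp Require Import finmap.
From mathcomp Require Import boolp classical_sets.
From mathcomp Require Import mpoly.
From mathcomp Require Import zify.

Set Implicit Arguments.
Unset Strict Implicit.
Unset Printing Implicit Defensive.

Import Defs GRing.Theory.
Local Open Scope ring_scope.
Local Open Scope classical_set_scope.

(** Call [x^eta F_gamma] a multiplicative multiple when [x^eta] only involves
    variables that are multiplicative for [x^gamma]. The terms [x^eta x^gamma] of
    the multiplicative multiples run once through the terms of [U], since the
    Pommaret cones partition these. Everything rests on a triangularity property
    ([lexlt_head]): if [x^eta] times a term outside [U] falls into the cone of
    [x^gamma] with cofactor [x^delta], then [x^delta] is smaller than [x^eta] for
    the lexicographic order comparing the highest variable first. So, for every
    marked set [F] over every algebra [A], rewriting heads by tails terminates,
    and the multiplicative multiples of [F] together with the terms of [N(U)]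
    form a basis of the free module over [A] ([marked_span],
    [supported_mult_inj]).

    The same order controls a non-multiplicative product [x_i F_alpha]: every
    cofactor in its reduction is below [x_i], which is what membership in the
    set of terms indexing the [B]'s expresses ([mem_s_terms], [marked_fsyz]).
    Hence, if [F] is a marked basis, the remainder in [<N(U)>] vanishes and
    [x_i F_alpha] is a combination of the allowed multiplicative multiples, with
    unique coefficients. Conversely, such relations turn every [x^epsilon F_gamma]
    into a combination of multiplicative multiples, because each rewriting step
    lowers [x^epsilon] ([fsyz_normal_form]); then [(F)] is spanned over [A] by the
    multiplicative multiples, so that [F] is a marked basis
    ([fundamental_marked_basis]), and the relations generate all syzygies
    ([syzygies_fundamental]).

    An algebra morphism from [K[B,C]/S] to [A] is a choice of values of the [C]'s,
    that is a marked set [F], and of values of the [B]'s satisfying these relations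
    ([Sideal_vanish]). To it corresponds the pair formed by the module generated
    by [F] and the syzygies of [F]. The pair determines [F], hence the [C]'s, and
    then the [B]'s. The pair is compatible with extension of scalars because both
    modules have generators given by formulas in the [B]'s and [C]'s: the marked
    basis and the fundamental syzygies. *)

(** * The lexicographic order on exponents *)

Section Lex.
Variable n : nat.
Implicit Types a b c : 'X_{1..n.+1}.

Definition lexlt a b : bool :=
  [exists j : 'I_n.+1, (a j < b j)%N
     && [forall k : 'I_n.+1, (j < k)%N ==> (a k == b k)]].

Lemma lexltP a b :
  reflect (exists j : 'I_n.+1,
             (a j < b j)%N /\ forall k : 'I_n.+1, (j < k)%N -> a k = b k)
          (lexlt a b).
Proof.
apply: (iffP existsP) => [[j /andP[ab /forallP h]]|[j [ab h]]]; exists j.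
  by split=> // k jk; apply/eqP/(implyP (h k)).
by rewrite ab; apply/forallP => k; apply/implyP => /h ->.
Qed.

Lemma lexltxx a : lexlt a a = false.
Proof. by apply/lexltP => -[j []]; rewrite ltnn. Qed.

Lemma lexlt_trans b a c : lexlt a b -> lexlt b c -> lexlt a c.
Proof.
move=> /lexltP[i [abi abk]] /lexltP[j [bcj bck]]; apply/lexltP.
case: (ltngtP i j) => [ij|ji|/val_inj ij].
- exists j; split; first by rewrite abk.
  by move=> k jk; rewrite abk ?bck // (ltn_trans ij).
- exists i; split; first by rewrite -bck.
  by move=> k ik; rewrite abk ?bck // (ltn_trans ji).
- rewrite -{j}ij in bcj bck; exists i; split; first exact: ltn_trans bcj.
  by move=> k ik; rewrite abk ?bck.
Qed.

Lemma lexlt_total a b : [\/ lexlt a b, a = b | lexlt b a].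
Proof.
have [->|/eqP ab] := eqVneq a b; first exact: Or32.
have [/existsP[i0 abi0]|/existsPn h] := boolP [exists i, a i != b i]; last first.
  by case: ab; apply/mnmP => i; apply/eqP; have := h i; rewrite negbK.
have [j abj jmax] :=
  @arg_maxnP _ i0 (fun i : 'I_n.+1 => a i != b i) (fun i : 'I_n.+1 => val i) abi0.
have top (k : 'I_n.+1) : (j < k)%N -> a k = b k.
  move=> jk; apply/eqP/negPn/negP => /jmax kj.
  by move: (leq_trans jk kj); rewrite ltnn.
move: abj; rewrite neq_ltn => /orP[lt|lt]; [apply: Or31|apply: Or33];
  by apply/lexltP; exists j; split=> // k /top.
Qed.

Lemma lexltD2l c a b : lexlt (c + a)%MM (c + b)%MM = lexlt a b.
Proof.
apply: eq_existsb => j; rewrite !mnmDE ltn_add2l; congr (_ && _).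
by apply: eq_forallb => k; rewrite !mnmDE eqn_add2l.
Qed.

(** Well-foundedness is proved by raising the number [m] of variables in which
    two exponents may differ: the top one decreases in [nat], and while it
    stays constant the previous case applies. *)
Lemma lexlt_wf : well_founded lexlt.
Proof.
pose lt m a b := exists j : 'I_n.+1,
  [/\ (j < m)%N, (a j < b j)%N & forall k : 'I_n.+1, (j < k)%N -> a k = b k].
suff wf m : (m <= n.+1)%N -> forall a, Acc (lt m) a.
  move=> a; elim: (wf n.+1 (leqnn _) a) => {}a _ IH; constructor => b.
  by case/lexltP => j [ba bk]; apply: IH; exists j; rewrite ltn_ord.
elim: m => [_ a|m IHm mn]; first by constructor => b [j []].
pose i := Ordinal mn; suff h N a : a i = N -> Acc (lt m.+1) a by move=> a; exact: h.
elim/ltn_ind: N a => N IHN a; elim: (IHm (ltnW mn) a) => {}a _ IHa aN.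
constructor => b [j [jm ba bk]].
have [ji|] := eqVneq j i; first by apply: (IHN (b i)) => //; rewrite -aN -ji.
rewrite -val_eqE /= => ji.
have {ji jm} jm : (j < m)%N by rewrite ltn_neqAle ji -ltnS.
by apply: IHa; [exists j|rewrite bk].
Qed.

Lemma lexlt_var a (i : 'I_n.+1) :
  lexlt a U_(i)%MM <-> forall j : 'I_n.+1, (i <= j)%N -> a j = 0%N.
Proof.
split=> [/lexltP[k [ak top]] j ij|a0].
  move: ak; rewrite mnm1E; case: eqP => // ik; rewrite -{k}ik in top * => ai.
  have [ij'|ji|/val_inj <-] := ltngtP i j.
  - by rewrite top // mnm1E; case: eqP => // ij0; rewrite ij0 ltnn in ij'.
  - by rewrite leqNgt ji in ij.
  - by case: (a i) ai.
apply/lexltP; exists i; rewrite mnm1E eqxx a0 //; split=> // k ik.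
rewrite a0; last exact: ltnW.
by rewrite mnm1E; case: eqP => // ik0; rewrite ik0 ltnn in ik.
Qed.

End Lex.

Lemma seq_maximal (T : eqType) (r : rel T) (s : seq T) (x : T) :
  irreflexive r -> transitive r -> x \in s ->
  exists2 y, y \in s & forall z, z \in s -> ~~ r y z.
Proof.
move=> rI rT; elim: s x => // a s IH x _.
case: s IH => [_|b s /(_ b (mem_head _ _))[y ys ymax]].
  by exists a; rewrite ?mem_head // => z; rewrite inE => /eqP ->; rewrite rI.
have [ya|nya] := boolP (r y a).
  exists a; first exact: mem_head.
  move=> z; rewrite inE => /orP[/eqP ->|/ymax]; first by rewrite rI.
  by apply: contra; exact: rT.
exists y; first by rewrite inE ys orbT.
by move=> z; rewrite inE => /orP[/eqP ->|/ymax].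
Qed.

(** * Free modules and their terms *)

Section FreeModule.
Variables (A : comNzRingType) (n : nat) (J : finType).
Local Notation V := (fmod A n J).
Local Notation R := ({mpoly A[n.+1]}).
Implicit Types (t u : mterm n J) (v w : V) (a : 'X_{1..n.+1}).

Lemma tcoef_zmod t : zmod_morphism (@tcoef A n J t).
Proof. by move=> v w; rewrite /tcoef !ffunE; exact: mcoeffB. Qed.

HB.instance Definition _ t :=
  GRing.isZmodMorphism.Build V A (@tcoef A n J t) (tcoef_zmod t).

Lemma tcoefZ t (c : A) v : tcoef t ((c%:MP : R) *: v) = c * tcoef t v.
Proof. by rewrite /tcoef ffunE; exact: mcoeffCM. Qed.

Lemma fmodP v w : (forall t, tcoef t v = tcoef t w) -> v = w.
Proof. by move=> h; apply/ffunP => k; apply/mpolyP => a; exact: (h (a, k)). Qed.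

Definition tsupp v : seq (mterm n J) :=
  undup [seq (a, k) | k <- enum J, a <- msupp (v k : R)].

Lemma mem_tsupp t v : (t \in tsupp v) = (tcoef t v != 0).
Proof.
rewrite mem_undup /tcoef -mcoeff_msupp; apply/allpairsPdep/idP.
  by move=> [k [a [_ h ->]]].
by move=> h; exists t.2, t.1; rewrite mem_enum -surjective_pairing.
Qed.

Lemma fmodE v : v = \sum_(t <- tsupp v) (((tcoef t v)%:MP : R) *: tm A t).
Proof.
apply: fmodP => u; rewrite raddf_sum /=.
have h t : tcoef u (((tcoef t v)%:MP : R) *: tm A t) = tcoef t v * (t == u)%:R.
  by rewrite tcoefZ tcoef_tm.
under eq_bigr => t _ do rewrite h.
have [uv|uv] := boolP (u \in tsupp v).
  rewrite (bigD1_seq u) ?undup_uniq //= eqxx mulr1 big1 ?addr0 // => t /negPf ->.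
  exact: mulr0.
rewrite big_seq big1 => [|t tv]; last first.
  by case: eqP => [E|_]; [rewrite -E tv in uv|exact: mulr0].
by apply/eqP; move: uv; rewrite mem_tsupp negbK.
Qed.

(** Submodules over the coefficients [A] only: neither [<N(U)>] nor the span of the
    multiplicative multiples need be stable under multiplication by variables. *)
Definition linear_set (W : set V) : Prop :=
  W 0 /\ forall (c : A) v w, W v -> W w -> W ((c%:MP : R) *: v + w).

Lemma linear_setD W v w : linear_set W -> W v -> W w -> W (v + w).
Proof. by move=> [_ h] Wv Ww; rewrite -[v]scale1r -mpolyC1; exact: h. Qed.

Lemma linear_setZ W c v : linear_set W -> W v -> W ((c%:MP : R) *: v).
Proof. by move=> [h0 h] Wv; rewrite -[_ *: _]addr0; exact: h. Qed.

Lemma linear_set_sum W (T : eqType) (s : seq T) (f : T -> V) :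
  linear_set W -> (forall x, x \in s -> W (f x)) -> W (\sum_(x <- s) f x).
Proof.
move=> lW h; rewrite big_seq; elim/big_ind: _ => //; first by case: lW.
by move=> v w; exact: linear_setD.
Qed.

Lemma linear_set_terms W v : linear_set W ->
  (forall t, tcoef t v != 0 -> W (tm A t)) -> W v.
Proof.
move=> lW h; rewrite [v]fmodE; apply: linear_set_sum => // t.
by rewrite mem_tsupp => /h; exact: linear_setZ.
Qed.

(** [supported N] is the A-span of the terms in [N], described by the
    vanishing of coefficients. *)
Definition supported (N : set (mterm n J)) : set V :=
  [set v | forall t, tcoef t v != 0 -> N t].

Lemma supported_linear N : linear_set (supported N).
Proof.
split=> [t|c v w Nv Nw t]; first by rewrite raddf0 eqxx.
rewrite raddfD /= tcoefZ; have [->|/Nv //] := eqVneq (tcoef t v) 0.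
by rewrite mulr0 add0r; exact: Nw.
Qed.

Lemma supported0 N : supported N 0.
Proof. by case: (supported_linear N). Qed.

Lemma supportedD N v w : supported N v -> supported N w -> supported N (v + w).
Proof. by move=> Nv Nw; exact: (linear_setD (supported_linear N) Nv Nw). Qed.

Lemma supportedP N c v w : supported N v -> supported N w ->
  supported N ((c%:MP : R) *: v + w).
Proof. by case: (supported_linear N) => _; apply. Qed.

Lemma supportedB N v w : supported N v -> supported N w -> supported N (v - w).
Proof.
move=> Nv Nw; rewrite addrC -scaleN1r -mpolyC1 -mpolyCN.
exact: supportedP.
Qed.

Lemma supported_tm (N : set (mterm n J)) t : N t -> supported N (tm A t).
Proof. by move=> Nt u; rewrite tcoef_tm; have [<-|] := eqVneq t u; rewrite ?eqxx. Qed.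

Lemma supported_Ztm (N : set (mterm n J)) c t : N t ->
  supported N ((c%:MP : R) *: tm A t).
Proof. by move=> Nt; exact: (linear_setZ c (supported_linear N) (supported_tm Nt)). Qed.

Lemma tspanE N : @tspan A n J N = supported N.
Proof.
apply/seteqP; split=> [v [s [sN ->]]|v Nv].
  apply: linear_set_sum => [|q /sN Nq]; first exact: supported_linear.
  exact: supported_Ztm.
exists [seq (tcoef t v, t) | t <- tsupp v]; split; last by rewrite big_map -fmodE.
by move=> q /mapP[t]; rewrite mem_tsupp => /Nv Nt ->.
Qed.

Lemma submodule_linear (M : set V) : submodule (R := R) M -> linear_set M.
Proof. by case=> M0 h; split=> // c v w; exact: h. Qed.

Lemma submoduleZ (M : set V) (r : R) v : submodule (R := R) M -> M v -> M (r *: v).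
Proof. by move=> [M0 h] Mv; rewrite -[_ *: _]addr0; exact: h. Qed.

Lemma submoduleB (M : set V) v w : submodule (R := R) M -> M v -> M w -> M (v - w).
Proof. by move=> [_ h] Mv Mw; rewrite addrC -scaleN1r; exact: h. Qed.

Lemma span_min (X M : set V) : submodule (R := R) M ->
  X `<=` M -> span (R := R) X `<=` M.
Proof.
move=> Ms XM v [s [sX ->]]; apply: linear_set_sum; first exact: submodule_linear.
by move=> q /sX /XM; exact: submoduleZ.
Qed.

End FreeModule.

(** * Multiples of the elements of a Pommaret basis *)

Lemma nonmult_gt0 n (a : 'X_{1..n.+1}) i : nonmult a i -> (0 < i)%N.
Proof. by rewrite /nonmult; case: minvar => // j /(leq_ltn_trans _) ->. Qed.

Section Heads.
Variables (K : fieldType) (n : nat) (I : finType) (d : I -> int).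
Variables (U : set (fmod K n I)) (P : {fset mterm n I}).
Hypothesis hP : pommaret_basis U P.
Implicit Types (w : mterm n P) (t u : mterm n I) (a : 'X_{1..n.+1}).

Definition mult w : Prop := forall i, nonmult (val w.2).1 i -> w.1 i = 0%N.

(** The term that [x^eta F_gamma] inherits from the head of [F_gamma]. *)
Definition head_term w : mterm n I := ((w.1 + (val w.2).1)%MM, (val w.2).2).

Lemma terms_in_dvd t u : terms_in U t -> u.2 = t.2 ->
  (forall i, t.1 i <= u.1 i)%N -> terms_in U u.
Proof.
case: hP => UP _ Ut u2 tu.
have -> : u = ((u.1 - t.1 + t.1)%MM, t.2).
  by rewrite submK -?u2 -?surjective_pairing //; apply/mnm_lepP.
rewrite /terms_in /= -tmZ; apply: submoduleZ => //.
by rewrite UP; exact: span_submodule.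
Qed.

Lemma terms_in_head w : terms_in U (head_term w).
Proof.
apply: (terms_in_dvd (terms_in_P hP w.2)) => // i.
by rewrite mnmDE leq_addl.
Qed.

Lemma cone_head w : mult w -> cone (val w.2) (head_term w).
Proof. by exists w.1. Qed.

Lemma head_surj t : terms_in U t -> exists2 w, mult w & head_term w = t.
Proof.
case: hP => _ [cov _ _]; rewrite -cov => -[t' t'P [a am ->]].
by exists (a, [` t'P]%fset).
Qed.

Lemma head_inj w w' : mult w -> mult w' -> head_term w = head_term w' -> w = w'.
Proof.
case: hP => _ [_ triv _] mw mw' E.
have E2 : w.2 = w'.2.
  apply/val_inj/triv; [exact: valP w.2|exact: valP w'.2|].
  by exists (head_term w); split; [|rewrite E]; exact: cone_head.
rewrite [w]surjective_pairing [w']surjective_pairing E2; congr pair.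
by apply/mnmP => i; have := congr1 (fun t => t.1 i) E; rewrite /= !mnmDE E2 => /addIn.
Qed.

(** The order that makes reduction terminate. If [a] times a term outside [U]
    lies in the cone of [g] with cofactor [e], then [e] is smaller than [a]: at
    the highest variable where they differ, a larger [e] would involve a
    multiplicative variable of [g], below which [g] has no variable, so that [g]
    would divide the given term. *)
Lemma lexlt_head w a u : mult w -> Nterms U u ->
  head_term w = ((a + u.1)%MM, u.2) -> lexlt w.1 a.
Proof.
move=> mw Nu E.
have E1 i : (w.1 i + (val w.2).1 i = a i + u.1 i)%N.
  by have := congr1 (fun t => t.1 i) E; rewrite /= !mnmDE.
have E2 : u.2 = (val w.2).2 by have := congr1 snd E.
have Pu : ~ forall i, ((val w.2).1 i <= u.1 i)%N.
  by move=> h; apply: Nu; exact: (terms_in_dvd (terms_in_P hP w.2)).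
case: (lexlt_total w.1 a) => // [wa|/lexltP[j [aw top]]].
  by case: Pu => i; have := E1 i; rewrite wa; lia.
case: Pu => i; have [ij|ji|ij] := ltngtP i j; last first.
- by have := E1 j; rewrite (val_inj ij); lia.
- by have := E1 i; rewrite top //; lia.
case m : (minvar (val w.2).1) => [l|]; last by rewrite (minvarN m) mnm0E.
have jl : (j <= l)%N.
  rewrite leqNgt; apply/negP => lj.
  by move: aw; rewrite (mw j) // /nonmult m.
have [_ lmin] := minvarP m; rewrite leqNgt; apply/negP => ui.
by have := lmin i (leq_ltn_trans (leq0n _) ui); lia.
Qed.

Lemma tdeg_head w : tdeg d (head_term w) = (mdeg w.1)%:Z + tdeg d (val w.2).
Proof. by rewrite /tdeg /= mdegD PoszD addrA. Qed.

(** The bounds on [max x^eta] say that [x^eta] is multiplicative and below [x_i]. *)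
Lemma mem_s_terms (q : nm_pair P) w : w \in s_terms K d q <->
  [/\ mult w, lexlt w.1 U_((val q).1)%MM &
      tdeg d (head_term w) = tdeg d (val (val q).2) + 1].
Proof.
rewrite in_s_terms tdeg_head; set i := (val q).1.
have i0 : (0 < i)%N := nonmult_gt0 (valP q).
split=> [/and3P[/eqP dw /asboolP/Nterms_U1 mw mx]|[mw wi dw]].
  split=> //; apply/lexlt_var => j ij; apply/eqP/negPn; rewrite -lt0n; apply/negP.
  move: mx; rewrite /max_le; case m : (maxvar w.1) => [l|].
    have [_ lmax] := maxvarP m; case/andP => li _ /lmax jl.
    by move: (leq_trans ij (leq_trans jl li)); lia.
  move=> _ wj; move: m; rewrite /maxvar; case: pickP => // h _.
  have [l wl lmax] :=
    @arg_maxnP _ j (fun k : 'I_n.+1 => 0 < w.1 k)%N (fun k : 'I_n.+1 => val k) wj.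
  have /negP[] := h l; rewrite [(0 < _)%N]wl; apply/forallP => k; apply/implyP.
  exact: lmax.
apply/and3P; split; [exact/eqP|exact/asboolP/Nterms_U1|].
rewrite /max_le; case m : (maxvar w.1) => [l|//]; have [wl _] := maxvarP m.
apply/andP; split.
  suff : (l < i)%N by lia.
  by rewrite ltnNge; apply/negP => il; rewrite (iffLR (lexlt_var _ _) wi) in wl.
case m' : (minvar _) => [k|//]; rewrite leqNgt; apply/negP => kl.
by rewrite mw // /nonmult m' in wl.
Qed.

End Heads.

(** * Linear combinations of a family of module elements *)

Section Combination.
Variables (A : comNzRingType) (n : nat) (I J : finType).
Local Notation R := ({mpoly A[n.+1]}).
Implicit Types (F : J -> fmod A n I) (s : fmod A n J).

Definition comb F s : fmod A n I := \sum_(t : J) (s t : R) *: F t.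

Lemma comb_linear F : linear (comb F).
Proof.
move=> p s s'; rewrite /comb scaler_sumr -big_split; apply: eq_bigr => t _ /=.
by rewrite !ffunE scalerDl scalerA.
Qed.

HB.instance Definition _ F :=
  GRing.isLinear.Build R (fmod A n J) (fmod A n I) *:%R (comb F) (comb_linear F).

Lemma combB F s s' : comb F (s - s') = comb F s - comb F s'.
Proof. exact: raddfB. Qed.

Lemma comb_tm F (w : mterm n J) : comb F (tm A w) = ('X_[w.1] : R) *: F w.2.
Proof.
rewrite /comb (bigD1 w.2) //= ffunE eqxx big1 ?addr0 // => t /negPf tw.
by rewrite ffunE tw scale0r.
Qed.

Lemma span_range F : span (R := R) (range F) = range (comb F).
Proof.
apply/seteqP; split.
  apply: span_min => [|_ [t _ <-]]; last first.
    by exists (tm A (0%MM, t)); rewrite ?comb_tm //= mpolyX0 scale1r.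
  split; first by exists 0; rewrite ?raddf0.
  by move=> p _ _ [s _ <-] [s' _ <-]; exists (p *: s + s'); rewrite ?linearP.
move=> _ [s _ <-]; exists [seq (s t : R, F t) | t <- enum J].
split; first by move=> q /mapP[t _ ->]; exists t.
by rewrite big_map big_enum.
Qed.

Lemma syzygies_submodule F : submodule (R := R) [set s | comb F s = 0].
Proof.
split; first by rewrite /= raddf0.
by move=> p s s' /= hs hs'; rewrite linearP /= hs hs' scaler0 addr0.
Qed.

End Combination.

(** * Reduction by a marked set *)

Section MarkedSets.
Variables (K : fieldType) (n : nat) (I : finType) (d : I -> int).
Variables (U : set (fmod K n I)) (P : {fset mterm n I}).
Hypothesis hP : pommaret_basis U P.
Variable A : comNzRingType.
Local Notation R := ({mpoly A[n.+1]}).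
Local Notation mult := (@mult n I P).
Implicit Types (F : P -> fmod A n I) (s : fmod A n P) (w : mterm n P).

Lemma tcoef_mulX_neq0 (J : finType) (u : mterm n J) a (v : fmod A n J) :
  tcoef u (('X_[a] : R) *: v) != 0 ->
  exists2 t, u = ((a + t.1)%MM, t.2) & tcoef t v != 0.
Proof.
move: u; rewrite -[forall u, _]/(supported _ _) {2}[v]fmodE scaler_sumr.
apply: linear_set_sum => [|t]; first exact: supported_linear.
rewrite mem_tsupp => tv; rewrite scalerA mulrC -scalerA tmZ.
by apply: supported_Ztm; exists t.
Qed.

Lemma marked_tail F t : marked_set d U F ->
  supported (Nterms U) (F t - tm A (val t)).
Proof. by case/(_ t). Qed.

Lemma marked_degree F t u : marked_set d U F ->
  tcoef u (F t) != 0 -> tdeg d u = tdeg d (val t).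
Proof.
case/(_ t) => [[e he] h1 _] hu.
by rewrite (he _ hu) (he (val t)) // h1 oner_neq0.
Qed.

Lemma mulX_marked_tail F (t : P) a u : marked_set d U F ->
  tcoef u (('X_[a] : R) *: (F t - tm A (val t))) != 0 ->
  exists t', [/\ u = ((a + t'.1)%MM, t'.2), Nterms U t' &
                 tdeg d u = (mdeg a)%:Z + tdeg d (val t)].
Proof.
move=> hF /tcoef_mulX_neq0 [t' -> h]; exists t'.
have Nt' := marked_tail hF h; split=> //.
rewrite /tdeg /= mdegD PoszD -addrA; congr (_ + _).
apply: (marked_degree hF); move: h; rewrite raddfB /= tcoef_tm.
have [E|_] := eqVneq (val t) t'; last by rewrite subr0.
by case: Nt'; rewrite -E; exact: (terms_in_P hP).
Qed.

Lemma mulX_marked F w : ('X_[w.1] : R) *: F w.2 =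
  tm A (head_term w) + ('X_[w.1] : R) *: (F w.2 - tm A (val w.2)).
Proof. by rewrite scalerBr tmZ addrC subrK. Qed.

(** The system of multiples [x^eta F_gamma] is triangular for the order of the
    cofactors [x^eta]. *)
Lemma tcoef_head F w x : marked_set d U F -> mult w -> mult x ->
  ~~ lexlt w.1 x.1 ->
  tcoef (head_term w) (('X_[x.1] : R) *: F x.2) = (x == w)%:R.
Proof.
move=> hF mw mx wx; rewrite mulX_marked raddfD /= tcoef_tm.
have -> : (head_term x == head_term w) = (x == w).
  by apply/eqP/eqP => [/(head_inj hP mx mw)|->].
apply/eqP; rewrite -subr_eq0 addrC addKr; apply/negPn/negP.
move=> /(mulX_marked_tail hF)[t' [E Nt' _]].
by rewrite (lexlt_head hP mw Nt' E) in wx.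
Qed.

(** The head of a term of [s] with maximal cofactor cannot be cancelled by the
    other terms, and it lies in [U]. *)
Lemma supported_mult_inj F s : marked_set d U F -> supported mult s ->
  supported (Nterms U) (comb F s) -> s = 0.
Proof.
move=> hF ms Ns; apply: fmodP => w0; rewrite raddf0.
apply/eqP/negPn; rewrite -mem_tsupp; apply/negP => w0s.
have [w ws wmax] := @seq_maximal _ (relpre fst (@lexlt n)) _ _
  (fun x => lexltxx x.1) (fun y x z => @lexlt_trans _ y.1 x.1 z.1) w0s.
have mw : mult w by apply: ms; rewrite -mem_tsupp.
suff E : tcoef (head_term w) (comb F s) = tcoef w s.
  have /Ns : tcoef (head_term w) (comb F s) != 0 by rewrite E -mem_tsupp.
  by case; exact: (terms_in_head hP).
rewrite {1}[s]fmodE linear_sum raddf_sum /=.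
have tE x : x \in tsupp s ->
    tcoef (head_term w) (comb F (((tcoef x s)%:MP : R) *: tm A x)) =
    tcoef x s * (x == w)%:R.
  move=> xs; rewrite linearZ /= tcoefZ comb_tm tcoef_head //; last exact: wmax.
  by apply: ms; rewrite -mem_tsupp.
rewrite (eq_big_seq _ tE) (bigD1_seq w) ?undup_uniq //= eqxx mulr1.
by rewrite big1 ?addr0 // => x /negPf ->; rewrite mulr0.
Qed.

(** [D] bounds the cofactors allowed in the reduction: replacing a head by the
    tail of its marked element only creates smaller cofactors, in the same
    degree [e]. *)
Lemma reduction F (W : set (fmod A n I)) (D : 'X_{1..n.+1} -> Prop) (e : int) :
  marked_set d U F -> linear_set W ->
  (forall a b, lexlt a b -> D b -> D a) ->
  (forall w, mult w -> D w.1 -> tdeg d (head_term w) = e ->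
     W (('X_[w.1] : R) *: F w.2)) ->
  (forall u, Nterms U u -> W (tm A u)) ->
  forall w, mult w -> D w.1 -> tdeg d (head_term w) = e -> W (tm A (head_term w)).
Proof.
move=> hF lW Dlt WF WN [a t]; elim: (lexlt_wf a) t => {}a _ IH t mw Da dw.
have -> : tm A (head_term (a, t)) =
    ((-1)%:MP : R) *: (('X_[a] : R) *: (F t - tm A (val t)))
    + ('X_[a] : R) *: F t.
  by rewrite mpolyCN mpolyC1 scaleN1r (mulX_marked F (a, t)) addrC addrK.
apply: lW.2; last exact: (WF (a, t)).
apply: linear_set_terms => // u /(mulX_marked_tail hF) [t' [E Nt' du]].
have [Uu|] := pselect (terms_in U u); last exact: WN.
have [w' mw' hw'] := head_surj hP Uu.
have w'a : lexlt w'.1 a by apply: (lexlt_head hP mw' Nt'); rewrite hw'.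
rewrite -hw'; have := IH _ w'a w'.2; rewrite -surjective_pairing; apply=> //.
  exact: Dlt Da.
by rewrite hw' du -dw tdeg_head.
Qed.

Lemma marked_span F v : marked_set d U F ->
  exists s r, [/\ supported mult s, supported (Nterms U) r & v = comb F s + r].
Proof.
move=> hF; pose W : set (fmod A n I) := [set v | exists s r,
  [/\ supported mult s, supported (Nterms U) r & v = comb F s + r]].
have lW : linear_set W.
  split.
    by exists 0, 0; rewrite raddf0 addr0; split=> //; apply: supported0.
  move=> c _ _ [s [r [ms Nr ->]]] [s' [r' [ms' Nr' ->]]].
  exists ((c%:MP : R) *: s + s'), ((c%:MP : R) *: r + r').
  split; try exact: supportedP.
  by rewrite linearP /= scalerDr addrACA.
have WN u : Nterms U u -> W (tm A u).
  move=> Nu; exists 0, (tm A u); rewrite raddf0 add0r; split=> //.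
    exact: supported0.
  exact: supported_tm.
rewrite -[exists s r, _]/(W v); apply: linear_set_terms => // u _.
have [Uu|] := pselect (terms_in U u); last exact: WN.
have [w mw <-] := head_surj hP Uu.
apply: (@reduction F W (fun=> True) (tdeg d (head_term w))) => // x mx _ _.
exists (tm A x), 0; rewrite addr0 comb_tm; split=> //; first exact: supported_tm.
exact: supported0.
Qed.

(** * The fundamental syzygies *)

Definition bsum (q : nm_pair P) (b : s_terms K d q -> A) : fmod A n P :=
  \sum_(w : s_terms K d q) ((b w)%:MP : R) *: tm A (val w).

(** It is a syzygy of [F] exactly when [x_i F_alpha] is the combination, with
    coefficients [b], of the multiplicative multiples allowed for [x_i]. *)
Definition fsyz (b : forall q : nm_pair P, s_terms K d q -> A) (q : nm_pair P) :
    fmod A n P :=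
  tm A (U_((val q).1)%MM, (val q).2) - bsum (b q).

Lemma bsum_mult (q : nm_pair P) (b : s_terms K d q -> A) : supported mult (bsum b).
Proof.
apply: linear_set_sum => [|w _]; first exact: supported_linear.
apply: supported_Ztm.
by have /mem_s_terms[] := valP w.
Qed.

Lemma tcoef_bsum (q : nm_pair P) (b : s_terms K d q -> A) (x : s_terms K d q) :
  tcoef (val x) (bsum b) = b x.
Proof.
have E y : tcoef (val x) (((b y)%:MP : R) *: tm A (val y)) = b y * (y == x)%:R.
  by rewrite tcoefZ tcoef_tm val_eqE.
transitivity (\sum_y b y * (y == x)%:R).
  by rewrite raddf_sum; apply: eq_bigr => y _; exact: E.
by rewrite (bigD1 x) //= eqxx mulr1 big1 ?addr0 // => y /negPf ->; rewrite mulr0.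
Qed.

(** The reduction of [x_i F_alpha] involves only cofactors below [x_i]: the head
    [x_i x^alpha] lies in a cone with such a cofactor ([pommaret_nonmult]), and so
    do the multiples of the tail that fall into [U] ([lexlt_head]). *)
Lemma marked_fsyz F (q : nm_pair P) : marked_set d U F ->
  exists b : s_terms K d q -> A,
    supported (Nterms U) (('X_((val q).1) : R) *: F (val q).2 - comb F (bsum b)).
Proof.
move=> hF; set i := (val q).1; set t := (val q).2.
pose W : set (fmod A n I) := [set v | exists b : s_terms K d q -> A,
  supported (Nterms U) (v - comb F (bsum b))].
have lW : linear_set W.
  split.
    exists (fun=> 0); rewrite /bsum big1 => [|w _]; last by rewrite mpolyC0 scale0r.
    by rewrite raddf0 subr0; exact: supported0.
  move=> c v v' [b Nb] [b' Nb']; exists (fun y => c * b y + b' y).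
  have -> : bsum (fun y => c * b y + b' y) = (c%:MP : R) *: bsum b + bsum b'.
    rewrite /bsum scaler_sumr -big_split; apply: eq_bigr => w _ /=.
    by rewrite mpolyCD mpolyCM scalerDl scalerA.
  rewrite linearP opprD addrACA -scalerBr.
  exact: (supportedP Nb Nb').
have WN u : Nterms U u -> W (tm A u).
  move=> Nu; exists (fun=> 0); rewrite /bsum big1.
    by rewrite raddf0 subr0; exact: supported_tm.
  by move=> w _; rewrite mpolyC0 scale0r.
pose e := tdeg d (val t) + 1.
have Wh w : mult w -> lexlt w.1 U_(i)%MM -> tdeg d (head_term w) = e ->
    W (tm A (head_term w)).
  apply: (@reduction F W (fun a => lexlt a U_(i)%MM) e) => //.
    by move=> a b ab /(lexlt_trans ab).
  move=> x mx xi dx; have xs : x \in s_terms K d q by apply/mem_s_terms.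
  exists (fun y => (y == [` xs]%fset)%:R).
  rewrite /bsum (bigD1 [` xs]%fset) //= eqxx mpolyC1 scale1r.
  rewrite big1 => [|y /negPf ->]; last by rewrite mpolyC0 scale0r.
  by rewrite addr0 comb_tm subrr; exact: supported0.
rewrite -[exists b, _]/(W _) (mulX_marked F (U_(i)%MM, t)); apply: linear_setD => //.
  have [w /eqP E] := pommaret_nonmult d hP q.
  have /mem_s_terms[mw wi dw] := valP w.
  by have := Wh _ mw wi dw; rewrite /head_term -E.
apply: linear_set_terms => // u /(mulX_marked_tail hF) [t' [E Nt' du]].
have [Uu|] := pselect (terms_in U u); last exact: WN.
have [w mw hw] := head_surj hP Uu.
rewrite -hw; apply: Wh => //; last by rewrite hw du mdeg1 addrC.
by apply: (lexlt_head hP mw Nt'); rewrite hw.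
Qed.

(** Rewriting along the fundamental syzygies terminates: [x_i x^e f_t] with
    [x_i] non-multiplicative becomes a combination of terms whose cofactors are
    below [x_i x^e]. *)
Lemma fsyz_normal_form b (M : set (fmod A n P)) s :
  submodule (R := R) M -> (forall q, M (fsyz b q)) ->
  exists2 s', supported mult s' & M (s - s').
Proof.
move=> sM Mb; pose W : set (fmod A n P) :=
  [set s | exists2 s', supported mult s' & M (s - s')].
have lM := submodule_linear sM.
have lW : linear_set W.
  split.
    exists 0; first exact: supported0.
    by rewrite subr0; exact: lM.1.
  move=> c v v' [s1 m1 M1] [s2 m2 M2]; exists ((c%:MP : R) *: s1 + s2).
    exact: supportedP.
  by rewrite opprD addrACA -scalerBr; exact: lM.2.
have WM v v' : M (v - v') -> W v' -> W v.
  move=> vv' [s' ms' Ms']; exists s' => //.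
  by rewrite -(subrK v' v) -addrA; apply: linear_setD.
rewrite -[exists2 s', _ & _]/(W s); apply: linear_set_terms => // -[a t] _.
elim: (lexlt_wf a) t => {}a _ IH t.
have [mat|nmat] := pselect (mult (a, t)).
  by exists (tm A (a, t)); [exact: supported_tm|rewrite subrr; exact: lM.1].
have [i [it ai]] : exists i, nonmult (val t).1 i /\ (0 < a i)%N.
  apply: contrapT => h; apply: nmat => i it; apply/eqP/negPn; rewrite -lt0n.
  by apply/negP => ai; apply: h; exists i.
pose q : nm_pair P := exist _ (i, t) it; pose a' := (a - U_(i))%MM.
have aE : (a' + U_(i))%MM = a.
  by rewrite submK //; apply/mnm_lepP => j; rewrite mnm1E; case: eqP => // <-.
apply: (WM _ (('X_[a'] : R) *: bsum (b q))).
  have -> : tm A (a, t) = ('X_[a'] : R) *: tm A (U_(i)%MM, t) by rewrite tmZ /= aE.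
  by rewrite -scalerBr; apply: submoduleZ => //; exact: (Mb q).
rewrite scaler_sumr; apply: linear_set_sum => // w _.
rewrite scalerA mulrC -scalerA tmZ; apply: linear_setZ => //; apply: IH.
have /mem_s_terms[_ wi _] := valP w.
by rewrite -[X in lexlt _ X]aE lexltD2l.
Qed.

Lemma eq_fsyz (b b' : forall q : nm_pair P, s_terms K d q -> A) q :
  b q =1 b' q -> fsyz b q = fsyz b' q.
Proof. by move=> /funext E; rewrite /fsyz E. Qed.

Definition fundamental (b : forall q : nm_pair P, s_terms K d q -> A) F : Prop :=
  forall q, comb F (fsyz b q) = 0.

Lemma syzygiesE F : syzygies F = [set s | comb F s = 0].
Proof. by []. Qed.

(** Modulo syzygies every combination is multiplicative, and multiplicative
    combinations meet [<N(U)>] only in zero. *)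
Lemma fundamental_marked_basis b F :
  marked_set d U F -> fundamental b F -> marked_basis d U F.
Proof.
move=> hF hb; split=> //; rewrite tspanE span_range; split=> v.
  have [s [r [_ Nr ->]]] := marked_span v hF.
  by exists (comb F s), r; split=> //; exists s.
case=> s _ <- Ns.
have [s' ms' /= Ms'] := fsyz_normal_form s (syzygies_submodule F) hb.
have E : comb F s = comb F s'.
  by apply/eqP; rewrite -subr_eq0 -raddfB /= Ms'.
by rewrite E in Ns *; rewrite (supported_mult_inj hF ms' Ns) raddf0.
Qed.

(** A syzygy is, modulo the fundamental ones, a multiplicative syzygy, and there
    is no such syzygy but zero. *)
Lemma syzygies_fundamental b F : marked_set d U F -> fundamental b F ->
  syzygies F = span (R := R) (range (fsyz b)).
Proof.
move=> hF hb; rewrite syzygiesE; apply/seteqP; split=> [s /= s0|]; last first.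
  apply: span_min => [|_ [q _ <-]]; [exact: syzygies_submodule|exact: hb].
have [s' ms' Ms'] : exists2 s', supported mult s' &
    span (R := R) (range (fsyz b)) (s - s').
  apply: (@fsyz_normal_form b); first exact: span_submodule.
  by move=> q; apply: span_sub; exists q.
suff s'0 : s' = 0 by rewrite s'0 subr0 in Ms'.
apply: (supported_mult_inj hF ms').
have : comb F (s - s') = 0.
  by apply: (span_min (syzygies_submodule F) _ Ms') => _ [q _ <-]; exact: hb.
rewrite combB s0 sub0r => /eqP; rewrite oppr_eq0 => /eqP ->.
exact: supported0.
Qed.

(** The relations are determined by the marked set, since two of them with the
    same leading product differ by a multiplicative syzygy. *)
Lemma fundamental_uniq b b' F : marked_set d U F ->
  fundamental b F -> fundamental b' F -> forall q y, b q y = b' q y.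
Proof.
move=> hF hb hb' q y; rewrite -!tcoef_bsum; congr tcoef.
apply/eqP; rewrite -subr_eq0; apply/eqP/(supported_mult_inj hF).
  by apply: supportedB; exact: bsum_mult.
have E (x v v' : fmod A n P) : v - v' = (x - v') - (x - v).
  by rewrite opprB [RHS]addrC addrA subrK.
rewrite (E (tm A (U_((val q).1)%MM, (val q).2))).
have -> := submoduleB (syzygies_submodule F) (hb' q) (hb q).
exact: supported0.
Qed.

(** For a marked basis the remainder of [x_i F_alpha] lies in [(F)] and in
    [<N(U)>], hence vanishes. *)
Lemma marked_basis_fundamental F : marked_basis d U F ->
  exists b, fundamental b F.
Proof.
case=> hF; rewrite tspanE span_range => -[_ triv].
have h q := cid (marked_fsyz q hF); exists (fun q => projT1 (h q)) => q.
apply: triv; first by exists (fsyz (fun q => projT1 (h q)) q).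
by rewrite combB comb_tm; exact: (projT2 (h q)).
Qed.

(** The tails of two marked sets lie in [<N(U)>], so that [F t - G t] lies in the
    common module and in [<N(U)>]. *)
Lemma marked_basis_uniq F G : marked_basis d U F -> marked_basis d U G ->
  span (R := R) (range F) = span (R := R) (range G) -> F =1 G.
Proof.
move=> [hF [_ tF]] [hG _] E t; apply/eqP; rewrite -subr_eq0; apply/eqP/tF.
  apply: submoduleB; first exact: span_submodule.
    by apply: span_sub; exists t.
  by rewrite E; apply: span_sub; exists t.
rewrite tspanE.
have -> : F t - G t = (F t - tm A (val t)) - (G t - tm A (val t)).
  by rewrite opprB addrA subrK.
by apply: supportedB; exact: marked_tail.
Qed.

Lemma graded_span F : marked_set d U F -> graded d (span (R := R) (range F)).
Proof.
move=> hF; rewrite span_range => _ [s _ <-].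
exists [seq comb F (((tcoef w s)%:MP : R) *: tm A w) | w <- tsupp s]; split; last first.
  by rewrite big_map {1}[s]fmodE linear_sum.
move=> _ /mapP[w _ ->]; split; first by exists (((tcoef w s)%:MP : R) *: tm A w).
exists ((mdeg w.1)%:Z + tdeg d (val w.2)) => u.
rewrite linearZ /= tcoefZ comb_tm => h.
have {h} : tcoef u (('X_[w.1] : R) *: F w.2) != 0.
  by apply: contraNneq h => ->; rewrite mulr0.
case/tcoef_mulX_neq0 => t -> /(marked_degree hF) <-.
by rewrite /tdeg /= mdegD PoszD addrA.
Qed.

Lemma Mf_syz_fundamental b F : marked_set d U F -> fundamental b F ->
  @Mf_syz K n I d U P A (span (R := R) (range F), syzygies F).
Proof.
move=> hF hb; have mF := fundamental_marked_basis hF hb; split => /=.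
- exact: span_submodule.
- exact: graded_span.
- by case: mF.
- by exists F.
Qed.

End MarkedSets.

(** * Extension of scalars *)

Section BaseChange.
Variables (A A' : comNzRingType) (phi : {rmorphism A -> A'}) (n : nat).

Section Extend.
Variable I : finType.
Local Notation R := ({mpoly A[n.+1]}).
Local Notation R' := ({mpoly A'[n.+1]}).

HB.instance Definition _ := GRing.isZmodMorphism.Build (fmod A n I) (fmod A' n I)
  (@map_fmod _ _ phi n I) (map_fmodB phi).

Lemma extend_span (X : set (fmod A n I)) :
  extend phi (span (R := R) X) = span (R := R') (@map_fmod _ _ phi n I @` X).
Proof.
apply/seteqP; split; apply: span_min; try exact: span_submodule; last first.
  by move=> _ [v Xv <-]; apply: span_sub; exists v => //; exact: span_sub.
have [S0 S] := span_submodule (R := R') (@map_fmod _ _ phi n I @` X).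
suff h : span (R := R) X `<=`
    [set v | span (R := R') (@map_fmod _ _ phi n I @` X) (map_fmod phi v)].
  by move=> _ [v /h hv <-].
apply: span_min => [|v Xv /=]; last by apply: span_sub; exists v.
split; first by rewrite /= raddf0.
by move=> a u v /= hu hv; rewrite raddfD /= map_fmodZ; exact: S.
Qed.

Lemma map_fmod_comp (A'' : comNzRingType) (psi : {rmorphism A' -> A''})
    (f : {rmorphism A -> A''}) : f =1 psi \o phi ->
  forall v : fmod A n I, map_fmod f v = map_fmod psi (map_fmod phi v).
Proof. by move=> E v; apply: fmodP => t; rewrite !tcoef_map E. Qed.

End Extend.

Variables (K : fieldType) (I : finType) (d : I -> int) (P : {fset mterm n I}).

Lemma map_fmod_fsyz (b : forall q : nm_pair P, s_terms K d q -> A) q :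
  map_fmod phi (fsyz b q) = fsyz (fun q y => phi (b q y)) q.
Proof.
rewrite /fsyz map_fmodB map_fmod_tm map_fmod_sum; congr (_ - _).
by apply: eq_bigr => y _; rewrite map_fmodZ map_mpolyC map_fmod_tm.
Qed.

End BaseChange.

(** * Morphisms out of a polynomial ring and out of a quotient *)

Section PolynomialMorphisms.
Variables (K : fieldType) (k : nat) (A : comAlgType K).

Lemma mpoly_morph_ext (f g : {lrmorphism {mpoly K[k]} -> A}) :
  (forall i, f 'X_i = g 'X_i) -> f =1 g.
Proof.
move=> fg p; rewrite [p]mpolyE !linear_sum; apply: eq_bigr => m _.
rewrite !linearZ mpolyXE_id !rmorph_prod /=; congr (_ *: _).
by apply: eq_bigr => i _; rewrite !rmorphXn /= fg.
Qed.

Definition mpoly_eval (x : 'I_k -> A) : {mpoly K[k]} -> A := mmap (in_alg A) x.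

HB.instance Definition _ x := GRing.RMorphism.on (mpoly_eval x).

Lemma mpoly_eval_scalable x : scalable (mpoly_eval x).
Proof. by move=> c p; rewrite /mpoly_eval mmapZ mulr_algl. Qed.

HB.instance Definition _ x :=
  GRing.isScalable.Build K {mpoly K[k]} A *:%R (mpoly_eval x) (mpoly_eval_scalable x).

End PolynomialMorphisms.

Section QuotientMorphisms.
Variables (K : fieldType) (R : comAlgType K) (J : idealr R) (A : comAlgType K).

Lemma quot_pi_surj (x : quotalg J) : exists p, quot_pi J p = x.
Proof. by exists (repr x); exact: reprK. Qed.

Variable g : {lrmorphism R -> A}.

(** The vanishing of [g] on [J] is an argument so that the algebra morphism
    structure can be attached to the map. *)
Definition quot_lift (_ : forall p, p \in (J : pred R) -> g p = 0)
  (x : quotalg J) : A := g (repr x).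

Hypothesis gJ : forall p, p \in (J : pred R) -> g p = 0.

Lemma quot_liftE p : quot_lift gJ (quot_pi J p) = g p.
Proof.
apply/eqP; rewrite -subr_eq0 -raddfB; apply/eqP/gJ.
rewrite -quot_pi_eq0 raddfB /= subr_eq0; apply/eqP; exact: reprK.
Qed.

Lemma quot_lift_zmod : zmod_morphism (quot_lift gJ).
Proof.
move=> x y; have [p <-] := quot_pi_surj x; have [r <-] := quot_pi_surj y.
by rewrite -raddfB !quot_liftE raddfB.
Qed.

Lemma quot_lift_monoid : monoid_morphism (quot_lift gJ).
Proof.
split; first by rewrite -(rmorph1 (quot_pi J)) quot_liftE rmorph1.
move=> x y; have [p <-] := quot_pi_surj x; have [r <-] := quot_pi_surj y.
by rewrite -rmorphM !quot_liftE rmorphM.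
Qed.

Lemma quot_lift_scalable : scalable (quot_lift gJ).
Proof.
move=> c x; have [p <-] := quot_pi_surj x.
by rewrite -linearZ !quot_liftE linearZ.
Qed.

HB.instance Definition _ :=
  GRing.isZmodMorphism.Build (quotalg J) A (quot_lift gJ) quot_lift_zmod.
HB.instance Definition _ :=
  GRing.isMonoidMorphism.Build (quotalg J) A (quot_lift gJ) quot_lift_monoid.
HB.instance Definition _ :=
  GRing.isScalable.Build K (quotalg J) A *:%R (quot_lift gJ) quot_lift_scalable.

End QuotientMorphisms.

(** * The points of the scheme *)

Section Points.
Variables (K : fieldType) (n : nat) (I : finType) (d : I -> int).
Variables (U : set (fmod K n I)) (P : {fset mterm n I}).
Hypothesis hP : pommaret_basis U P.
Local Notation KBC := (KBC d U P).
Local Notation Q := (KBC_mod_S d hP).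

Section MarkedOf.
Variable A : comNzRingType.
Local Notation R := ({mpoly A[n.+1]}).

(** The marked set with tail coefficients [c], that is the specialization of the
    generic one at [C = c]. *)
Definition marked_of (c : Cvar d U P -> A) (t : P) : fmod A n I :=
  tm A (val t) -
  \sum_(u : tail_terms d U t) ((c (Tagged _ u))%:MP : R) *: tm A (val u).

Lemma tcoef_tail c (t : P) (u : tail_terms d U t) :
  tcoef (val u) (marked_of c t) = - c (Tagged _ u).
Proof.
have Eu (v : tail_terms d U t) :
    tcoef (val u) (((c (Tagged _ v))%:MP : R) *: tm A (val v)) =
    c (Tagged _ v) * (v == u)%:R.
  by rewrite tcoefZ tcoef_tm val_eqE.
have tu : (val t == val u) = false.
  apply/eqP => E; have := valP u; rewrite in_tail_terms => /andP[_ /asboolP].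
  by case; rewrite -E; exact: (terms_in_P hP).
rewrite raddfB /= tcoef_tm tu sub0r; congr (- _).
transitivity (\sum_(v : tail_terms d U t) c (Tagged _ v) * (v == u)%:R).
  by rewrite raddf_sum; apply: eq_bigr => v _; exact: Eu.
by rewrite (bigD1 u) //= eqxx mulr1 big1 ?addr0 // => v /negPf ->; rewrite mulr0.
Qed.

Lemma marked_of_tail c t :
  supported [set u | Nterms U u /\ tdeg d u = tdeg d (val t)]
    (tm A (val t) - marked_of c t).
Proof.
rewrite opprB addrC subrK; apply: linear_set_sum => [|u _].
  exact: supported_linear.
apply: supported_Ztm; have := valP u; rewrite in_tail_terms.
by case/andP => /eqP du /asboolP Nu; split.
Qed.

Lemma marked_ofP c : marked_set d U (marked_of c).
Proof.
move=> t; have h := @marked_of_tail c t.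
have E u : tcoef u (marked_of c t) =
    (val t == u)%:R - tcoef u (tm A (val t) - marked_of c t).
  by rewrite -tcoef_tm -raddfB opprB addrC subrK.
split.
- exists (tdeg d (val t)) => u; rewrite E.
  have [-> //|_] := eqVneq (val t) u; rewrite sub0r oppr_eq0.
  by case/h.
- rewrite E eqxx.
  have [->|/h[]] := eqVneq (tcoef (val t) (tm A (val t) - marked_of c t)) 0.
    exact: subr0.
  by case; exact: (terms_in_P hP).
- by move=> u; rewrite -opprB raddfN /= oppr_eq0 => /h[].
Qed.

Lemma marked_of_surj (F : P -> fmod A n I) : marked_set d U F ->
  exists c, F =1 marked_of c.
Proof.
move=> hF; pose c (x : Cvar d U P) := - tcoef (val (tagged x)) (F (tag x)).
exists c => t.
apply/eqP; rewrite -subr_eq0; apply/eqP/fmodP => u; rewrite raddf0.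
have -> : F t - marked_of c t =
    (F t - tm A (val t)) + (tm A (val t) - marked_of c t) by rewrite addrA subrK.
apply/eqP/negPn/negP => h.
have [Nu du] : Nterms U u /\ tdeg d u = tdeg d (val t).
  move: u h; rewrite -[forall u, _]/(supported [set u | Nterms U u /\
    tdeg d u = tdeg d (val t)] _).
  apply: supportedD; last exact: marked_of_tail.
  move=> u h; have Nu := marked_tail hF h; split=> //.
  apply: (marked_degree hF); move: h; rewrite raddfB /= tcoef_tm.
  have [E|_] := eqVneq (val t) u; last by rewrite subr0.
  by case: Nu; rewrite -E; exact: (terms_in_P hP).
have us : u \in tail_terms d U t.
  by rewrite in_tail_terms du eqxx; apply/asboolP.
case/negP: h; rewrite addrA subrK raddfB /= -[u]/(val [` us]%fset) tcoef_tail.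
by rewrite /c opprK /= subrr.
Qed.

End MarkedOf.

Variable A : comAlgType K.

Lemma map_generic_marked (g : {rmorphism KBC -> A}) t :
  map_fmod g (generic_marked d U t) = marked_of (fun x => g (Cind x)) t.
Proof.
rewrite map_fmodB map_fmod_tm map_fmod_sum; congr (_ - _).
by apply: eq_bigr => u _; rewrite map_fmodZ map_mpolyC map_fmod_tm.
Qed.

Lemma map_generic_syz (g : {rmorphism KBC -> A}) q :
  map_fmod g (generic_syz d U q) =
  comb (marked_of (fun x => g (Cind x)))
    (fsyz (fun q y => g (Bind U (Tagged _ y))) q).
Proof.
rewrite map_fmodB map_fmodZ map_mpolyX map_generic_marked map_fmod_sum.
rewrite combB comb_tm /bsum; congr (_ - _).
rewrite [RHS]linear_sum; apply: eq_bigr => y _.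
rewrite map_fmodZ map_generic_marked linearZ /= comb_tm.
by rewrite rmorphM /= map_mpolyC map_mpolyX scalerA.
Qed.

Lemma Sideal_vanish (g : {rmorphism KBC -> A}) :
  (forall p, p \in (Sidealr d hP : pred KBC) -> g p = 0) <->
  fundamental (fun q y => g (Bind U (Tagged _ y)))
    (marked_of (fun x => g (Cind x))).
Proof.
split=> [g0 q|hg p].
  rewrite -map_generic_syz; apply: fmodP => t; rewrite tcoef_map raddf0.
  apply: g0; apply/asboolP; apply: span_sub; by exists q, t.
move/asboolP => -[s [sX ->]]; rewrite rmorph_sum big_seq big1 // => x /sX [q [t E]].
by rewrite rmorphM /= E -tcoef_map map_generic_syz hg raddf0 mulr0.
Qed.

Definition point (h : {lrmorphism Q -> A}) : {lrmorphism KBC -> A} :=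
  h \o quot_pi (Sidealr d hP).

Lemma point_vanish h p : p \in (Sidealr d hP : pred KBC) -> point h p = 0.
Proof. by rewrite -quot_pi_eq0 => /eqP /= ->; rewrite rmorph0. Qed.

Definition point_C h (x : Cvar d U P) : A := point h (Cind x).
Definition point_B h (q : nm_pair P) (y : s_terms K d q) : A :=
  point h (Bind U (Tagged _ y)).

Lemma point_fundamental h : fundamental (point_B h) (marked_of (point_C h)).
Proof. exact/Sideal_vanish/point_vanish. Qed.

Lemma point_surj (b : forall q : nm_pair P, s_terms K d q -> A) c :
  fundamental b (marked_of c) -> exists h, marked_of (point_C h) = marked_of c.
Proof.
move=> hb; pose x (i : 'I_#|{: Bvar K d P + Cvar d U P}|) : A :=
  match enum_val i with
  | inl y => b (tag y) (tagged y)
  | inr u => c u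
  end.
pose g : {lrmorphism KBC -> A} := mpoly_eval x.
have gB y : g (Bind U y) = b (tag y) (tagged y).
  by rewrite /g /= /mpoly_eval mmapX mmap1U /x enum_rankK.
have gC u : g (Cind u) = c u.
  by rewrite /g /= /mpoly_eval mmapX mmap1U /x enum_rankK.
have cE : marked_of (fun u => g (Cind u)) = marked_of c.
  by congr marked_of; apply/funext.
have g0 : forall p, p \in (Sidealr d hP : pred KBC) -> g p = 0.
  apply/Sideal_vanish => q.
  have -> : fsyz (fun q y => g (Bind U (Tagged _ y))) q = fsyz b q.
    by apply: eq_fsyz => y; exact: (gB (Tagged _ y)).
  by rewrite cE; exact: hb.
exists (quot_lift g0); rewrite -cE; congr marked_of; apply/funext => u.
exact: (quot_liftE g0).
Qed.

Lemma point_ext (h h' : {lrmorphism Q -> A}) :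
  (forall q, @point_B h q =1 @point_B h' q) -> point_C h =1 point_C h' -> h =1 h'.
Proof.
move=> EB EC x; have [p <-] := quot_pi_surj x.
apply: (@mpoly_morph_ext _ _ _ (point h) (point h')) => i.
rewrite -[i]enum_valK; case: (enum_val i) => [[q y]|u]; [exact: EB|exact: EC].
Qed.

End Points.

(** * The representing scheme *)

Theorem theorem4p9 (K : fieldType) (n m : nat) (d : 'I_m -> int)
    (U : set (fmod K n 'I_m)) (hU : quasi_stable U)
    (P : {fset mterm n 'I_m}) (hP : pommaret_basis U P) :
  @represents K (KBC_mod_S d hP)
    (fun A : comAlgType K => (set (fmod A n 'I_m) * set (fmod A n P))%type)
    (fun (A A' : comAlgType K) (phi : {lrmorphism A -> A'}) =>
       @extend_pair A A' phi n 'I_m P)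
    (fun A : comAlgType K => @Mf_syz K n 'I_m d U P A).
Proof.
pose F (A : comAlgType K) (h : {lrmorphism KBC_mod_S d hP -> A}) :=
  marked_of (point_C h).
have mF A h : marked_set d U (@F A h) by exact: marked_ofP.
exists (fun (A : comAlgType K) (h : {lrmorphism KBC_mod_S d hP -> A}) =>
  (span (R := {mpoly A[n.+1]}) (range (F A h)), syzygies (F A h))).
split=> [A _|A A' _ _ phi h].
  split.
  - move=> h.
    exact: (Mf_syz_fundamental hP (mF A h) (point_fundamental h)).
  - move=> g h /(congr1 fst)/= E.
    have bF := fundamental_marked_basis hP (mF A _) (point_fundamental _).
    have {}E : F A g =1 F A h by exact: (marked_basis_uniq (bF g) (bF h) E).
    have fE : F A g = F A h by exact/funext.
    apply: point_ext => [q y|[t u]].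
      apply: (fundamental_uniq hP (mF A g) (point_fundamental g)).
      by rewrite fE; exact: point_fundamental.
    apply: oppr_inj; rewrite -[LHS](tcoef_tail hP) -[RHS](tcoef_tail hP).
    exact: (congr1 (tcoef (val u)) (E t)).
  - case=> M S [_ _ _ [G [mG /= -> ->]]].
    have [c cE] := marked_of_surj hP mG.1.
    have [b hb] := marked_basis_fundamental hP mG.
    have GE : G = marked_of c by exact/funext.
    rewrite GE in hb *; have [h hE] := point_surj hP hb.
    by exists h; rewrite /F hE.
(* Extension of scalars commutes with spans, so it suffices to compare the
   marked bases here and the fundamental syzygies below. *)
have FE : F A' (phi \o h) = @map_fmod A A' phi n 'I_m \o F A h.
  apply/funext => t /=; rewrite /F.
  rewrite -[LHS](@map_generic_marked _ _ _ _ _ _ _ (point (phi \o h))).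
  rewrite -[marked_of _ t](@map_generic_marked _ _ _ _ _ _ _ (point h)).
  exact: map_fmod_comp.
congr pair => /=; first by rewrite extend_span image_comp -FE.
rewrite (syzygies_fundamental hP (mF A h) (point_fundamental h)).
rewrite (syzygies_fundamental hP (mF A' (phi \o h)) (point_fundamental _)).
rewrite extend_span image_comp.
suff -> : @fsyz _ _ _ d _ _ (point_B (phi \o h)) =
    @map_fmod A A' phi n P \o fsyz (point_B h) by [].
by apply/funext => q /=; rewrite map_fmod_fsyz.
Qed.
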